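(* Let $G=(V,E)$ be a $d$-regular graph on $n=|V|$ vertices with adjacency matrix $A$, and let $L = I - \frac{1}{d}A$ be its normalized Laplacian. For any $\delta \le 1/2$, $$\lambda_\delta \le \phi_\delta(G) \le \sqrt{(2-\lambda_\delta)\lambda_\delta},$$ where $\lambda_\delta = \min_{x\in\mathbb{R}^n,\ \|x\|_0 = \delta |V|} \frac{x^T L x}{x^T x}$.
   Context: For nonempty $S \subseteq V$, the expansion is $\phi_G(S) = \frac{|E(S,V\setminus S)|}{d\cdot \min(|S|,|V\setminus S|)}$, where $E(S,V\setminus S)$ is the set of edges with one endpoint in $S$ and the other in $V\setminus S$. For $0<\delta\le 1/2$, $\phi_\delta(G) = \min\{\phi_G(S) : S\subseteq V,\ S\neq\emptyset,\ |S|\le \delta n\}$. $\|x\|_0$ denotes the number of nonzero coordinates of $x$.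
   Formalization: The minimum defining λ_δ need not be attained and δ|V| need not be an integer, so λ_δ is taken as the infimum over ‖x‖₀ = ⌊δ|V|⌋; d ≥ 1, δ > 0 and δ|V| ≥ 1 are assumed so that L, φ_δ and λ_δ are defined. *)

(* Defs.v *)
From mathcomp Require Import all_boot all_order all_algebra.
From mathcomp Require Import classical_sets reals.

Set Implicit Arguments.
Unset Strict Implicit.
Unset Printing Implicit Defensive.

Import Order.TTheory GRing.Theory Num.Theory.

Local Open Scope ring_scope.

Record sgraph (V : finType) := SGraph {
  adj : rel V;
  adj_sym : symmetric adj;
  adj_irr : irreflexive adj
}.

Section Graph.
Variables (V : finType) (G : sgraph V).

Definition regular (d : nat) : Prop :=
  forall v : V, #|[set u | adj G v u]| = d.

(* Edges are unordered pairs [set u; v]. *)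
Definition edges_between (S T : {set V}) : {set {set V}} :=
  [set [set u; v] | u in S, v in T & adj G u v].

Variable R : realType.

Definition expansion (d : nat) (S : {set V}) : R :=
  #|edges_between S (~: S)|%:R / (d%:R * (minn #|S| #|~: S|)%:R).

(* The set is finite, so its infimum is a minimum as soon as it is nonempty,
   i.e. when 1 <= delta * #|V|; see small_set_expansion_min. *)
Definition small_set_expansion (d : nat) (delta : R) : R :=
  inf [set r | exists S : {set V},
    [/\ S != finset.set0, #|S|%:R <= delta * #|V|%:R & r = expansion d S]]%classic.

(* Vertices are indexed by 'I_#|V| through the enumeration of V. *)
Definition adjacency_mx : 'M[R]_#|V| :=
  \matrix_(i, j) (adj G (enum_val i) (enum_val j))%:R.

Definition laplacian_mx (d : nat) : 'M[R]_#|V| :=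
  1%:M - d%:R^-1 *: adjacency_mx.

End Graph.

Section Sparse.
Variable R : realType.

Definition norm0 (n : nat) (x : 'cV[R]_n) : nat := #|[set i | x i 0 != 0]|.

Definition rayleigh (n : nat) (L : 'M[R]_n) (x : 'cV[R]_n) : R :=
  (x^T *m L *m x) 0 0 / (x^T *m x) 0 0.

(* The sparsity level delta * n is rounded down, so that the constraint makes
   sense for every delta; it is the exact condition norm0 x = delta * n when
   delta * n is an integer (norm0_trunc). The "minimum" is an infimum: the set
   of vectors with exactly k nonzero coordinates is not closed, and the
   minimum need not be attained (three disjoint triangles, k = 4). *)
Definition sparse_eigenvalue (n : nat) (L : 'M[R]_n) (delta : R) : R :=
  inf [set r | exists x : 'cV[R]_n,
    norm0 x = Num.truncn (delta * n%:R) /\ r = rayleigh L x]%classic.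

End Sparse.

Lemma norm0_trunc (R : realType) (n k : nat) (delta : R) (x : 'cV[R]_n) :
  delta * n%:R = k%:R ->
  norm0 x = Num.truncn (delta * n%:R) <-> (norm0 x)%:R = delta * n%:R.
Proof.
move=> ->; rewrite natrK; split=> [->//|/eqP].
by rewrite eqr_nat => /eqP.
Qed.

Lemma small_set_expansion_min (V : finType) (G : sgraph V) (R : realType)
    (d : nat) (delta : R) :
  1 <= delta * #|V|%:R ->
  exists S : {set V},
    [/\ S != finset.set0, #|S|%:R <= delta * #|V|%:R,
        small_set_expansion G d delta = expansion G R d S &
        forall T : {set V}, T != finset.set0 -> #|T|%:R <= delta * #|V|%:R ->
          expansion G R d S <= expansion G R d T].
Proof.
move=> d1.
have [v _] : exists v : V, v \in V.
  apply/card_gt0P; rewrite lt0n; apply: contraTN d1 => /eqP ->.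
  by rewrite mulr0 ler10.
pose P (S : {set V}) := (S != finset.set0) && (#|S|%:R <= delta * #|V|%:R).
have P0 : P [set v].
  by rewrite /P cards1 d1 andbT; apply/finset.set0Pn; exists v; rewrite inE.
case: (arg_minP (expansion G R d) P0) => S /andP[S0 Sd] minS.
have minT (T : {set V}) : T != finset.set0 -> #|T|%:R <= delta * #|V|%:R ->
    expansion G R d S <= expansion G R d T.
  by move=> T0 Td; apply: minS; rewrite /P T0.
exists S; split=> //; apply/eqP; rewrite eq_le; apply/andP; split.
  apply: ge_inf; last by exists S.
  by exists (expansion G R d S) => _ [T [T0 Td ->]]; apply: minT.
apply: lb_le_inf; first by exists (expansion G R d S), S.
by move=> _ [T [T0 Td ->]]; apply: minT.
Qed.

(* Main.v *)
Require Import Defs.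
From mathcomp Require Import all_boot all_order all_algebra.
From mathcomp Require Import classical_sets reals.
From mathcomp Require Import ring lra.

Import Order.TTheory GRing.Theory Num.Theory.

Local Open Scope ring_scope.

(* Write [k] for the integer part of [delta * #|V|].

   Lower bound: the indicator of a set [S] with at most [k <= #|V| / 2] vertices
   has Rayleigh quotient equal to the expansion of [S], and it is a limit of
   vectors with exactly [k] nonzero entries.

   Upper bound: let [x] have [k] nonzero entries and Rayleigh quotient [rho].
   Every superlevel set of [x ^ 2] has at most [k] vertices, so the coarea
   inequality bounds the sum of [|x_u ^ 2 - x_v ^ 2|] over edges from below by
   [phi * d * |x| ^ 2]. Factoring [x_u ^ 2 - x_v ^ 2] and applying
   Cauchy-Schwarz bounds it from above by
   [d * |x| ^ 2 * sqrt (rho * (2 - rho))], because the Dirichlet sums of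
   [x_u - x_v] and [x_u + x_v] are [d * rho * |x| ^ 2] and
   [d * (2 - rho) * |x| ^ 2]. *)

(** Pads a small vertex set to exactly [k] vertices; applied to the empty set, it also yields a
    vector with exactly [k] nonzero entries. *)
Lemma superset_of_card (T : finType) (S : {set T}) (k : nat) :
  (#|S| <= k <= #|T|)%N -> exists2 U : {set T}, S \subset U & #|U| = k.
Proof.
elim: k => [|k IHk] /andP[Sk kT].
  by exists S => //; apply/eqP; rewrite -leqn0.
move: Sk; rewrite leq_eqVlt ltnS => /orP[/eqP Sk|Sk]; first by exists S.
have [|U SU Uk] := IHk; first by rewrite Sk ltnW.
have [v vU] : exists v, v \in ~: U.
  by apply/card_gt0P; rewrite cardsCs finset.setCK Uk subn_gt0.
exists (v |: U); first by rewrite (fintype.subset_trans SU) ?finset.subsetUr.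
by move: vU; rewrite inE cardsU1 Uk => ->.
Qed.

(** The weights [w] will be adjacency indicators, which restrict a sum over all ordered pairs to the
    edges. *)
Lemma sumr_cauchy_schwarz (R : realDomainType) (I : finType) (w p q : I -> R) :
  (forall i, 0 <= w i) ->
  (\sum_i w i * (p i * q i)) ^+ 2 <=
  (\sum_i w i * p i ^+ 2) * (\sum_i w i * q i ^+ 2).
Proof.
move=> w0.
(* Lagrange's identity. *)
suff E : \sum_i \sum_j w i * w j * (p i * q j - p j * q i) ^+ 2 =
    2 * ((\sum_i w i * p i ^+ 2) * (\sum_i w i * q i ^+ 2)
         - (\sum_i w i * (p i * q i)) ^+ 2).
  rewrite -subr_ge0 -(pmulr_rge0 _ (ltr0n R 2)) -E.
  by do 2!(apply: sumr_ge0 => ? _); rewrite mulr_ge0 ?sqr_ge0 ?mulr_ge0.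
have dist (f g : I -> R) :
    (\sum_i f i) * (\sum_j g j) = \sum_i \sum_j f i * g j.
  by rewrite big_distrl; apply: eq_bigr => i _; rewrite big_distrr.
have polar (a b c : R) : 2 * (a * b - c ^+ 2) = a * b + b * a - 2 * (c * c).
  by ring.
rewrite polar !dist [2 * _]mulr_sumr -big_split -sumrB.
apply: eq_bigr => i _ /=.
rewrite mulr_sumr -big_split -sumrB; apply: eq_bigr => j _ /=; ring.
Qed.

(** * Edge sums, cuts and the coarea inequality *)

Section Dirichlet.
Variables (R : realType) (V : finType) (G : sgraph V).
Implicit Types (f g : V -> R) (S T : {set V}).

(* Both orientations of each edge are counted. *)
Definition edge_sum (F : V -> V -> R) : R :=
  \sum_u \sum_v (adj G u v)%:R * F u v.

Lemma ler_edge_sum F F' :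
  (forall u v, F u v <= F' u v) -> edge_sum F <= edge_sum F'.
Proof.
by move=> FF'; do 2!(apply: ler_sum => ? _); rewrite ler_wpM2l ?FF'.
Qed.

Lemma edge_sum_cauchy_schwarz F F' :
  edge_sum (fun u v => F u v * F' u v) ^+ 2 <=
  edge_sum (fun u v => F u v ^+ 2) * edge_sum (fun u v => F' u v ^+ 2).
Proof.
rewrite /edge_sum !pair_big /=.
exact: (sumr_cauchy_schwarz _ _ (fun e => (adj G e.1 e.2)%:R)
  (fun e => F e.1 e.2) (fun e => F' e.1 e.2)).
Qed.

(** An edge between disjoint sets has one endpoint in each, so the unordered edge determines its
    ordered pair. *)
Lemma card_edges_between S T : [disjoint S & T] ->
  #|edges_between G S T|%:R =
  \sum_(u in S) \sum_(v in T) (adj G u v)%:R :> R.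
Proof.
move=> dST.
have notT u : u \in S -> u \in T = false by move/(disjointFr dST).
pose E := [set e : V * V | [&& e.1 \in S, e.2 \in T & adj G e.1 e.2]].
have -> : edges_between G S T = [set [set e.1; e.2] | e in E].
  apply/setP=> e; apply/imset2P/imsetP => [[u v uS]|[[u v]]].
    by rewrite inE => /andP[vT uv] ->; exists (u, v); rewrite // inE uS vT.
  by rewrite inE /= => /and3P[uS vT uv ->]; exists u v; rewrite // inE vT.
rewrite card_in_imset; last first.
  move=> [u v] [u' v']; rewrite !inE /= => /and3P[uS vT _] /and3P[u'S v'T _].
  move=> /setP eq_e; congr pair; apply/eqP.
    move: (eq_e u); rewrite !inE eqxx /= => /esym/orP[//|/eqP uv'].
    by move: v'T; rewrite -uv' notT.
  move: (eq_e v); rewrite !inE eqxx orbT => /esym/orP[/eqP vu'|//].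
  by move: vT; rewrite vu' notT.
rewrite pair_big_dep -sum1_card natr_sum /= [RHS]big_mkcond [LHS]big_mkcond.
apply: eq_bigr => -[u v] _; rewrite inE /= andbA.
by case: (u \in S); case: (v \in T); case: (adj G u v).
Qed.

(** The factor 2 arises because each cut edge is met once from its endpoint in [S] and once from the
    other. *)
Lemma edge_sum_cut S :
  edge_sum (fun u v => `|(u \in S)%:R - (v \in S)%:R|) =
  2 * #|edges_between G S (~: S)|%:R.
Proof.
rewrite card_edges_between; last by rewrite -setI_eq0 finset.setICr.
rewrite mulr_natl mulr2n {2}exchange_big /= /edge_sum.
rewrite (bigID (mem S)) /=; congr (_ + _).
  apply: eq_bigr => u uS; rewrite [RHS]big_mkcond; apply: eq_bigr => v _.
  rewrite inE uS; case: (v \in S).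
    by rewrite subrr normr0 mulr0.
  by rewrite subr0 normr1 mulr1.
rewrite (eq_bigl (mem (~: S))) => [|u]; last by rewrite /= inE.
apply: eq_bigr => u; rewrite /= inE => /negPf uS.
rewrite [RHS]big_mkcond; apply: eq_bigr => v _.
rewrite uS adj_sym; case: (v \in S).
  by rewrite sub0r normrN normr1 mulr1.
by rewrite subrr normr0 mulr0.
Qed.

Variable d : nat.
Hypothesis d_gt0 : (0 < d)%N.
Hypothesis G_regular : regular G d.

Lemma edge_sum_left f : edge_sum (fun u _ => f u) = d%:R * \sum_u f u.
Proof.
rewrite /edge_sum mulr_sumr; apply: eq_bigr => u _.
rewrite -mulr_suml -(G_regular u) -sum1_card natr_sum [in RHS]big_mkcond.
by congr (_ * _); apply: eq_bigr => v _; rewrite inE; case: adj.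
Qed.

Lemma edge_sum_swap F : edge_sum (fun u v => F v u) = edge_sum F.
Proof.
rewrite /edge_sum exchange_big; apply: eq_bigr => u _; apply: eq_bigr => v _.
by rewrite adj_sym.
Qed.

Lemma edge_sumD F F' :
  edge_sum (fun u v => F u v + F' u v) = edge_sum F + edge_sum F'.
Proof.
rewrite -big_split; apply: eq_bigr => u _; rewrite -big_split.
by apply: eq_bigr => v _; rewrite mulrDr.
Qed.

Lemma edge_sumZ c F : edge_sum (fun u v => c * F u v) = c * edge_sum F.
Proof.
rewrite mulr_sumr; apply: eq_bigr => u _; rewrite mulr_sumr.
by apply: eq_bigr => v _; rewrite mulrCA.
Qed.

Lemma eq_edge_sum F F' :
  (forall u v, F u v = F' u v) -> edge_sum F = edge_sum F'.
Proof. by move=> E; do 2!(apply: eq_bigr => ? _); rewrite E. Qed.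

(** One expansion serves both Dirichlet sums: [c = -1] for differences, [c = 1] for sums. *)
Lemma edge_sum_sqrD c f :
  edge_sum (fun u v => (f u + c * f v) ^+ 2) =
  (1 + c ^+ 2) * (d%:R * \sum_u f u ^+ 2)
  + 2 * c * edge_sum (fun u v => f u * f v).
Proof.
rewrite -(edge_sum_left (fun u => f u ^+ 2)) mulrDl mul1r -!edge_sumZ.
rewrite -[X in _ + X + _]edge_sum_swap -!edge_sumD.
by apply: eq_edge_sum => u v; ring.
Qed.

(* The coarea inequality, by peeling off the lowest level set of [f]. *)
Lemma edge_sum_coarea (c : R) (k : nat) f :
  (forall S, (0 < #|S| <= k)%N ->
     c * #|S|%:R <= #|edges_between G S (~: S)|%:R) ->
  (forall u, 0 <= f u) -> (#|[set u | f u != 0%R]| <= k)%N ->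
  2 * c * \sum_u f u <= edge_sum (fun u v => `|f u - f v|).
Proof.
move=> cP; have [m] := ubnP #|[set u | f u != 0%R]|.
elim: m f => // m IHm f; rewrite ltnS => fm f0 fk.
set S := [set u | f u != 0%R] in fm fk.
have notS u : u \notin S -> f u = 0 by rewrite inE negbK => /eqP.
have [S0|[u0 u0S]] := set_0Vmem S.
  rewrite big1 => [|u _]; last by rewrite notS // S0 inE.
  rewrite mulr0; do 2!(apply: sumr_ge0 => ? _).
  by rewrite mulr_ge0.
(* Subtracting the least value of [f] on its support keeps the function nonnegative and drops [w]
   from the support, so induction on the support size applies. *)
case: (arg_minP f u0S) => w wS minw; have {}wS : w \in S := wS.
pose g u := f u - f w * (u \in S)%:R.
have gS u : u \notin S -> g u = 0.
  by move=> uS; rewrite /g notS // (negPf uS) mulr0 subr0.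
have g0 u : 0 <= g u.
  have [uS|/gS -> //] := boolP (u \in S).
  by rewrite /g uS mulr1 subr_ge0 minw.
have gm : (#|[set u | g u != 0%R]| < #|S|)%N.
  apply: proper_card; apply/properP; split; last first.
    by exists w => //; rewrite inE /g wS mulr1 subrr eqxx.
  by apply/fintype.subsetP => u; rewrite inE; apply: contraR => /gS ->.
have := IHm g (leq_trans gm fm) g0 (leq_trans (ltnW gm) fk).
have Sk : (0 < #|S| <= k)%N by rewrite fk andbT; apply/card_gt0P; exists u0.
(* Absolute values add exactly: inside or outside [S] the indicator difference is 0, and across the
   boundary both differences have the same sign because [g] vanishes off [S]. *)
have -> : edge_sum (fun u v => `|f u - f v|) =
    f w * edge_sum (fun u v => `|(u \in S)%:R - (v \in S)%:R|)
    + edge_sum (fun u v => `|g u - g v|).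
  rewrite -edge_sumZ -edge_sumD; apply: eq_edge_sum => u v.
  have ff u' : f u' = f w * (u' \in S)%:R + g u' by rewrite /g; ring.
  have fg w' : `|f w + g w'| = f w + g w'.
    by rewrite ger0_norm // (addr_ge0 (f0 w) (g0 w')).
  rewrite (ff u) (ff v).
  have [uS|/gS ->] := boolP (u \in S); have [vS|/gS ->] := boolP (v \in S);
    rewrite /= ?mulr1 ?mulr0 ?addr0.
  - by rewrite subrr normr0 mulr0 add0r; congr `| _ |; ring.
  - by rewrite !subr0 normr1 mulr1 fg (ger0_norm (g0 u)).
  - by rewrite !sub0r !normrN normr1 mulr1 fg (ger0_norm (g0 v)).
  - by rewrite !subrr normr0 mulr0 addr0.
have -> : \sum_u f u = f w * #|S|%:R + \sum_u g u.
  have -> : #|S|%:R = \sum_u (u \in S)%:R :> R.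
    rewrite -sum1_card natr_sum big_mkcond; apply: eq_bigr => u _.
    by case: (u \in S).
  by rewrite sumrB -mulr_sumr addrC subrK.
rewrite edge_sum_cut; have := ler_wpM2l (f0 w) (cP S Sk).
nra.
Qed.

Lemma sparse_cheeger (c : R) (k : nat) f :
  0 <= c ->
  (forall S, (0 < #|S| <= k)%N ->
     c * (d%:R * #|S|%:R) <= #|edges_between G S (~: S)|%:R) ->
  (#|[set u | f u != 0%R]| <= k)%N ->
  (2 * c * (d%:R * \sum_u f u ^+ 2)) ^+ 2 <=
  edge_sum (fun u v => (f u - f v) ^+ 2)
  * edge_sum (fun u v => (f u + f v) ^+ 2).
Proof.
move=> c0 cP fk.
have := @edge_sum_coarea (c * d%:R) k (fun u => f u ^+ 2).
move=> /(_ _ (fun u => sqr_ge0 _)) coarea.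
have le1 : 2 * c * (d%:R * \sum_u f u ^+ 2) <=
    edge_sum (fun u v => `|f u - f v| * `|f u + f v|).
  rewrite mulrA -(mulrA 2) (le_trans (coarea _ _)) //.
  - by move=> S /cP; rewrite mulrA.
  - rewrite (eq_card (B := [set u | f u != 0%R])) // => u.
    by rewrite !inE sqrf_eq0.
  - by apply: ler_edge_sum => u v; rewrite subr_sqr normrM.
have sum0 : 0 <= \sum_u f u ^+ 2 by apply: sumr_ge0 => u _; apply: sqr_ge0.
have := edge_sum_cauchy_schwarz (fun u v => `|f u - f v|)
  (fun u v => `|f u + f v|).
have sq (h : V -> V -> R) :
    edge_sum (fun u v => `|h u v| ^+ 2) = edge_sum (fun u v => h u v ^+ 2).
  by apply: eq_edge_sum => u v; rewrite real_normK ?num_real.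
have le0 : 0 <= 2 * c * (d%:R * \sum_u f u ^+ 2) by rewrite !mulr_ge0.
by rewrite !sq; apply: le_trans; rewrite ler_sqr ?nnegrE // (le_trans le0).
Qed.


Lemma norm0E (x : 'cV[R]_#|V|) :
  norm0 x = #|[set u | x (enum_rank u) 0 != 0]|.
Proof.
rewrite /norm0 -(card_imset _ (@enum_val_inj _ V)); apply: eq_card => u.
rewrite [in RHS]inE; apply/imsetP/idP => [[i + ->]|xu].
  by rewrite inE enum_valK.
by exists (enum_rank u); rewrite ?inE ?enum_rankK.
Qed.

Lemma sum_enum_rank (F : 'I_#|V| -> R) :
  \sum_i F i = \sum_(u : V) F (enum_rank u).
Proof. by rewrite (reindex _ (onW_bij _ (@enum_rank_bij V))). Qed.

Lemma sqr_normE (x : 'cV[R]_#|V|) :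
  (x^T *m x) 0 0 = \sum_u x (enum_rank u) 0 ^+ 2.
Proof.
by rewrite mxE sum_enum_rank; apply: eq_bigr => u _; rewrite mxE expr2.
Qed.

Lemma adjacency_formE (x : 'cV[R]_#|V|) :
  (x^T *m adjacency_mx G R *m x) 0 0 =
  edge_sum (fun u v => x (enum_rank u) 0 * x (enum_rank v) 0).
Proof.
rewrite mxE sum_enum_rank -edge_sum_swap; apply: eq_bigr => v _.
rewrite mxE sum_enum_rank mulr_suml; apply: eq_bigr => u _.
by rewrite !mxE !enum_rankK adj_sym; ring.
Qed.

Lemma laplacian_formE (x : 'cV[R]_#|V|) :
  d%:R * (x^T *m laplacian_mx G R d *m x) 0 0 =
  d%:R * (x^T *m x) 0 0 - (x^T *m adjacency_mx G R *m x) 0 0.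
Proof.
have d0 : d%:R != 0 :> R by rewrite pnatr_eq0 -lt0n.
rewrite /laplacian_mx mulmxBr mulmx1 -scalemxAr mulmxBl -scalemxAl.
by rewrite mxE [X in _ + X]mxE [X in - X]mxE mulrBr mulVKf.
Qed.

Lemma edge_sum_sqrB_laplacian (x : 'cV[R]_#|V|) :
  edge_sum (fun u v => (x (enum_rank u) 0 - x (enum_rank v) 0) ^+ 2) =
  2 * (d%:R * (x^T *m laplacian_mx G R d *m x) 0 0).
Proof.
rewrite laplacian_formE adjacency_formE sqr_normE.
under eq_edge_sum do rewrite -mulN1r.
by rewrite (edge_sum_sqrD (-1) (fun u => x (enum_rank u) 0)); ring.
Qed.

Lemma edge_sum_sqrD_laplacian (x : 'cV[R]_#|V|) :
  edge_sum (fun u v => (x (enum_rank u) 0 + x (enum_rank v) 0) ^+ 2) =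
  2 * (d%:R * (2 * (x^T *m x) 0 0 - (x^T *m laplacian_mx G R d *m x) 0 0)).
Proof.
rewrite [d%:R * _]mulrBr laplacian_formE adjacency_formE sqr_normE.
have := edge_sum_sqrD 1 (fun u => x (enum_rank u) 0).
by under eq_edge_sum do rewrite mul1r; move=> ->; ring.
Qed.

Lemma rayleigh_laplacian_ge0 (x : 'cV[R]_#|V|) :
  0 <= rayleigh (laplacian_mx G R d) x.
Proof.
rewrite divr_ge0 ?sqr_normE ?sumr_ge0 // => [|u _]; last exact: sqr_ge0.
have dR : 0 < d%:R :> R by rewrite ltr0n.
rewrite -(pmulr_rge0 _ dR).
rewrite -(pmulr_rge0 _ (ltr0n R 2)) -edge_sum_sqrB_laplacian.
by do 2!(apply: sumr_ge0 => ? _); rewrite mulr_ge0 ?sqr_ge0.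
Qed.

Lemma sqr_norm_gt0 (x : 'cV[R]_#|V|) : (0 < norm0 x)%N -> 0 < (x^T *m x) 0 0.
Proof.
rewrite norm0E => /card_gt0P[u]; rewrite inE => xu0.
rewrite sqr_normE (bigD1 u) //= ltr_pwDl //.
  by rewrite lt_neqAle eq_sym sqrf_eq0 xu0 sqr_ge0.
by apply: sumr_ge0 => v _; apply: sqr_ge0.
Qed.

Lemma rayleighK (x : 'cV[R]_#|V|) : (0 < norm0 x)%N ->
  (x^T *m laplacian_mx G R d *m x) 0 0 =
  rayleigh (laplacian_mx G R d) x * (x^T *m x) 0 0.
Proof. by move=> /sqr_norm_gt0 x0; rewrite divfK // gt_eqF. Qed.

Lemma sparse_cheeger_rayleigh (c : R) (x : 'cV[R]_#|V|) :
  0 <= c -> (0 < norm0 x)%N ->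
  (forall S, (0 < #|S| <= norm0 x)%N ->
     c * (d%:R * #|S|%:R) <= #|edges_between G S (~: S)|%:R) ->
  c ^+ 2 <= (2 - rayleigh (laplacian_mx G R d) x)
            * rayleigh (laplacian_mx G R d) x.
Proof.
move=> c0 x0 cP.
have := @sparse_cheeger c (norm0 x) (fun u => x (enum_rank u) 0) c0 cP.
rewrite -norm0E => /(_ (leqnn _)).
rewrite edge_sum_sqrB_laplacian edge_sum_sqrD_laplacian -sqr_normE rayleighK //.
set rho := rayleigh _ _; set N := (x^T *m x) 0 0 => H.
(* Both sides of [H] carry this common factor, which is cancelled. *)
have dN : 0 < (2 * (d%:R * N)) ^+ 2 :> R.
  by rewrite exprn_gt0 // !mulr_gt0 ?ltr0n ?sqr_norm_gt0.
rewrite -(ler_pM2r dN); move: H; congr (_ <= _); ring.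
Qed.

(* Vectors with exactly [k] nonzero entries are dense among those with at most
   [k]: the indicator of [S] is perturbed by [e] on [T :\: S]. *)
Lemma le_cut_of_le_rayleigh (lambda : R) (k : nat) S :
  0 <= lambda -> (0 < #|S| <= k)%N -> (k <= #|V|)%N ->
  (forall x : 'cV[R]_#|V|, norm0 x = k ->
     lambda <= rayleigh (laplacian_mx G R d) x) ->
  lambda * (d%:R * #|S|%:R) <= #|edges_between G S (~: S)|%:R.
Proof.
move=> l0 /andP[S0 Sk] kV lP.
have [|T ST Tk] := @superset_of_card V S k; first by rewrite Sk.
(* Passing from the indicator of [S] to [f] raises each squared difference by at most [e ^+ 2 <= e];
   3 is a generous constant, summed over [d * #|V|] oriented edges. *)
have bound (e : R) : 0 < e -> e <= 1 ->
    2 * (lambda * (d%:R * #|S|%:R)) <=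
    2 * #|edges_between G S (~: S)|%:R + e * (3 * (d%:R * #|V|%:R)).
  move=> e0 e1; pose f u : R := if u \in S then 1 else e * (u \in T)%:R.
  pose x : 'cV[R]_#|V| := \col_i f (enum_val i).
  have xf u : x (enum_rank u) 0 = f u by rewrite mxE enum_rankK.
  have xk : norm0 x = k.
    rewrite norm0E -Tk; apply: eq_card => u; rewrite inE xf /f.
    have [/(fintype.subsetP ST) ->|_] := boolP (u \in S).
      exact: oner_neq0.
    by rewrite mulf_eq0 gt_eqF //= pnatr_eq0 eqb0 negbK.
  have := lP x xk; have x0 : (0 < norm0 x)%N by rewrite xk (leq_trans S0).
  rewrite -(ler_pM2r (sqr_norm_gt0 _ x0)) -rayleighK // => le_form.
  have leN : #|S|%:R <= (x^T *m x) 0 0.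
    rewrite sqr_normE -sum1_card natr_sum big_mkcond; apply: ler_sum => u _.
    by rewrite xf /f; case: ifP => _; rewrite ?expr1n ?sqr_ge0.
  have d0 : 0 <= d%:R :> R by [].
  apply: (@le_trans _ _ (2 * (d%:R * (x^T *m laplacian_mx G R d *m x) 0 0))).
    rewrite ler_pM2l // mulrCA ler_wpM2l // (le_trans _ le_form) //.
    by rewrite ler_wpM2l.
  rewrite -edge_sum_sqrB_laplacian -edge_sum_cut.
  have -> : e * (3 * (d%:R * #|V|%:R)) = edge_sum (fun _ _ => e * 3).
    rewrite (edge_sum_left (fun=> e * 3)) sumr_const -mulr_natr; ring.
  rewrite -edge_sumD; apply: ler_edge_sum => u v; rewrite !xf /f.
  case: (u \in S); case: (v \in S);
    rewrite ?subrr ?subr0 ?sub0r ?normrN ?normr1 ?normr0.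
  - nra.
  - case: (v \in T) => /=; nra.
  - case: (u \in T) => /=; nra.
  - case: (u \in T); case: (v \in T) => /=; nra.
rewrite -(ler_pM2l (ltr0n R 2)); apply/ler_addgt0Pr => e e0.
set C := 3 * (d%:R * #|V|%:R) in bound.
have C0 : 0 <= C by rewrite !mulr_ge0.
(* Chosen so that [e' <= 1] and [e' * C <= e]; [C + 1] keeps the divisor positive. *)
pose e' := Num.min 1 (e / (C + 1)).
have C1 : 0 < C + 1 by rewrite ltr_wpDl.
have e'0 : 0 < e' by rewrite lt_min ltr01 divr_gt0.
apply: le_trans (bound e' e'0 _) _; first by rewrite ge_min lexx.
rewrite lerD2l; apply: (@le_trans _ _ (e / (C + 1) * (C + 1))).
  apply: ler_pM => //; [exact: ltW | | by rewrite lerDl].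
  by rewrite ge_min lexx orbT.
by rewrite divfK // gt_eqF.
Qed.

End Dirichlet.

(** * Passage from individual sets and vectors to the two infima *)

Theorem theorem2 (R : realType) (V : finType) (G : sgraph V) (d : nat)
    (delta : R)
    (d_gt0 : (0 < d)%N)
    (G_regular : regular G d)
    (delta_gt0 : 0 < delta)
    (delta_le : delta <= 1 / 2%:R)
    (delta_ge : 1 <= delta * #|V|%:R) :
  let lambda := sparse_eigenvalue (laplacian_mx G R d) delta in
  lambda <= small_set_expansion G d delta
  /\ small_set_expansion G d delta <= Num.sqrt ((2%:R - lambda) * lambda).
Proof.
move=> lambda; pose k := Num.truncn (delta * #|V|%:R).
have dV0 : 0 <= delta * #|V|%:R := le_trans ler01 delta_ge.
have k0 : (0 < k)%N by rewrite truncn_gt0.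
have lek (S : {set V}) : (#|S| <= k)%N = (#|S|%:R <= delta * #|V|%:R).
  exact: truncn_ge_nat.
(* Sets of at most [k] vertices are thus the smaller side of their cut, which resolves the minimum
   in [expansion]. *)
have k2V : (k + k <= #|V|)%N.
  rewrite -(ler_nat R) natrD.
  have : k%:R <= delta * #|V|%:R by rewrite truncn_le.
  have := ler_wpM2r (ler0n R #|V|) delta_le; lra.
have kV : (k <= #|V|)%N := leq_trans (leq_addr k k) k2V.
have expE (S : {set V}) : (0 < #|S| <= k)%N ->
    0 < d%:R * #|S|%:R :> R
    /\ expansion G R d S = #|edges_between G S (~: S)|%:R / (d%:R * #|S|%:R).
  move=> /andP[S0 Sk]; split; first by rewrite mulr_gt0 ?ltr0n.
  rewrite /expansion (minn_idPl _) // -(leq_add2l #|S|) cardsC.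
  by rewrite (leq_trans _ k2V) // leq_add.
have lb0 : has_lbound [set r | exists x : 'cV[R]_#|V|,
    norm0 x = k /\ r = rayleigh (laplacian_mx G R d) x]%classic.
  by exists 0 => _ [x [_ ->]]; apply: rayleigh_laplacian_ge0.
have lambda_le (x : 'cV[R]_#|V|) : norm0 x = k ->
    lambda <= rayleigh (laplacian_mx G R d) x.
  by move=> xk; apply: ge_inf => //; exists x.
(* [inf] takes a default value on the empty set, so a competitor is needed: the indicator of a
   [k]-set. *)
have [x0 x0k] : exists x : 'cV[R]_#|V|, norm0 x = k.
  have [|T _ Tk] := @superset_of_card V finset.set0 k.
    by rewrite finset.cards0 kV.
  exists (\col_i (enum_val i \in T)%:R); rewrite norm0E -Tk.
  by apply: eq_card => u; rewrite inE mxE enum_rankK pnatr_eq0 eqb0 negbK.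
have le_lambda (y : R) : (forall x : 'cV[R]_#|V|, norm0 x = k ->
    y <= rayleigh (laplacian_mx G R d) x) -> y <= lambda.
  move=> yP; apply: lb_le_inf => [|_ [x [xk ->]]]; last exact: yP.
  by exists (rayleigh (laplacian_mx G R d) x0), x0.
have lambda0 : 0 <= lambda.
  by apply: le_lambda => x _; apply: rayleigh_laplacian_ge0.
have [S [S0 Sd -> minS]] := small_set_expansion_min G d delta_ge.
set phi := expansion G R d S.
have Sk : (0 < #|S| <= k)%N by rewrite card_gt0 S0 lek.
have le_phi : lambda <= phi.
  have [dS0 E] := expE S Sk; rewrite /phi E ler_pdivlMr //.
  exact: le_cut_of_le_rayleigh lambda_le.
split=> //.
have phi0 : 0 <= phi := le_trans lambda0 le_phi.
have cheeger (x : 'cV[R]_#|V|) : norm0 x = k ->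
    phi ^+ 2 <= (2 - rayleigh (laplacian_mx G R d) x)
                * rayleigh (laplacian_mx G R d) x.
  move=> xk; apply: sparse_cheeger_rayleigh; rewrite ?xk // => T Tk.
  have [dT0 E] := expE T Tk; rewrite -ler_pdivlMr // -E.
  by case/andP: Tk => T0 Tk; rewrite minS -?lek // -card_gt0.
(* The bound on each Rayleigh quotient passes to the infimum in the form
   [1 - Num.sqrt (1 - phi ^+ 2) <= rho]. *)
have sqrt_le : 1 - Num.sqrt (1 - phi ^+ 2) <= lambda.
  apply: le_lambda => x /cheeger; set rho := rayleigh _ _ => phi_rho.
  (* Since [(2 - rho) * rho = 1 - (1 - rho) ^+ 2], the bound reads
     [(1 - rho) ^+ 2 <= 1 - phi ^+ 2]. *)
  rewrite lerBlDr -lerBlDl (le_trans (ler_norm _)) // -sqrtr_sqr.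
  by apply: ler_wsqrtr; lra.
(* [Num.sqrt] is 0 on negative numbers, so squaring it back requires this. *)
have phi1 : phi ^+ 2 <= 1.
  have := cheeger x0 x0k; set rho := rayleigh _ _.
  by have := sqr_ge0 (1 - rho); lra.
have s2 : Num.sqrt (1 - phi ^+ 2) ^+ 2 = 1 - phi ^+ 2.
  by rewrite sqr_sqrtr // subr_ge0.
have s0 : 0 <= Num.sqrt (1 - phi ^+ 2) := sqrtr_ge0 _.
(* Follows from [lambda <= phi <= 1]. With [1 - lambda >= 0], squaring [1 - lambda <= s] gives
   [(1 - lambda) ^+ 2 <= 1 - phi ^+ 2], the claimed bound. *)
have lambda1 : lambda <= 1 by nra.
rewrite -(ger0_norm phi0) -sqrtr_sqr; apply: ler_wsqrtr.
set s := Num.sqrt _ in sqrt_le s2 s0.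
nra.
Qed.
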